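(* Let $p$ be any one of the following six mesh patterns $(12,R)$: $R_1=\{0,1,2\}^2$; $R_2=\{(0,1),(1,0),(1,1),(1,2),(2,1)\}$; $R_3=\{(0,1),(0,2),(1,0),(1,1),(1,2),(2,0),(2,1)\}$; $R_4=\{(0,0),(0,1),(1,0),(1,1),(1,2),(2,1),(2,2)\}$; $R_5=\{(0,0),(0,1),(1,0),(1,1),(1,2),(2,1)\}$; $R_6=\{(0,1),(0,2),(1,0),(1,1),(1,2),(2,1)\}$. Then $\sum_{n\ge0}t^n\sum_{\sigma\in K_n}u^{p(\sigma)}=A(t)$.
   Context: A permutation $\sigma=\sigma_1\cdots\sigma_n$ of $\{1,\dots,n\}$ is a king permutation if $|\sigma_{i+1}-\sigma_i|>1$ for all $1\le i\le n-1$. $K_n$ is the set of king permutations of length $n$ ($K_0$ = the empty permutation) and $A(t)=\sum_{n\ge0}|K_n|t^n$ (known to equal $\sum_{n\ge0}n!\,t^n(1-t)^n/(1+t)^n$). For a mesh pattern $p=(12,R)$ with $R\subseteq\{0,1,2\}^2$, an occurrence of $p$ in $\sigma\in S_n$ is a pair of positions $i_1<i_2$ with $\sigma_{i_1}<\sigma_{i_2}$ such that for every $(x,y)\in R$ there is no position $m$ with $i_x<m<i_{x+1}$ and $v_y<\sigma_m<v_{y+1}$, where $i_0=0$, $i_3=n+1$, $v_0=0$, $v_1=\sigma_{i_1}$, $v_2=\sigma_{i_2}$, $v_3=n+1$ (the first coordinate of a box indexes positions, the second values). $p(\sigma)$ denotes the number of occurrences of $p$ in $\sigma$. *)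

(* Defs.v *)
From HB Require Import structures.
From mathcomp Require Export all_boot all_order all_fingroup all_algebra.

Set Implicit Arguments.
Unset Strict Implicit.
Unset Printing Implicit Defensive.

Import Order.TTheory GRing.Theory Num.Theory.

(* Positions and values are 0-based in 'S_n, so the 1-based ones are i.+1 and
   (s i).+1. *)

Definition king (n : nat) (s : 'S_n) : bool :=
  [forall i : 'I_n, forall j : 'I_n,
     (j == i.+1 :> nat) ==> (1 < `|(s j).+1 - (s i).+1|)%N].

Definition K (n : nat) : {set 'S_n} := [set s | king s].

(* The mesh pattern (12, R) is represented by its shading R; a box (x, y) has
   first coordinate x indexing positions and second coordinate y values. *)
Definition mesh12 := {set 'I_3 * 'I_3}.

Definition shading (boxes : seq (nat * nat)) : mesh12 :=
  [set b : 'I_3 * 'I_3 | (val b.1, val b.2) \in boxes].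

(* i_0, i_1, i_2, i_3 for an occurrence at the positions i < j *)
Definition pos_bound (n : nat) (i j : 'I_n) (x : nat) : nat :=
  nth 0 [:: 0; i.+1; j.+1; n.+1] x.

(* v_0, v_1, v_2, v_3 *)
Definition val_bound (n : nat) (s : 'S_n) (i j : 'I_n) (y : nat) : nat :=
  nth 0 [:: 0; (s i).+1; (s j).+1; n.+1] y.

Definition in_box (n : nat) (s : 'S_n) (i j : 'I_n) (b : 'I_3 * 'I_3)
    (m : 'I_n) : bool :=
  (pos_bound i j b.1 < m.+1 < pos_bound i j b.1.+1) &&
  (val_bound s i j b.2 < (s m).+1 < val_bound s i j b.2.+1).

Definition occurrence (R : mesh12) (n : nat) (s : 'S_n) (i j : 'I_n) : bool :=
  [&& i < j, s i < s j &
      [forall b in R, ~~ [exists m : 'I_n, in_box s i j b m]]].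

Definition occ (R : mesh12) (n : nat) (s : 'S_n) : nat :=
  #|[set ij : 'I_n * 'I_n | occurrence R s ij.1 ij.2]|.

(* A formal power series in t is its sequence of coefficients; equality of
   series is =1. *)
Definition fps (C : Type) := nat -> C.

Definition A (C : pzSemiRingType) : fps C := fun n => (#|K n|%:R)%R.

(* The joint distribution of occ R over king permutations, in Z[u][[t]]; the
   indeterminate u is 'X. *)
Definition king_gf (R : mesh12) : fps {poly int} :=
  fun n => (\sum_(s in K n) 'X^(occ R s))%R.

Definition R1 : mesh12 := [set: 'I_3 * 'I_3].
Definition R2 : mesh12 := shading [:: (0,1); (1,0); (1,1); (1,2); (2,1)].
Definition R3 : mesh12 :=
  shading [:: (0,1); (0,2); (1,0); (1,1); (1,2); (2,0); (2,1)].
Definition R4 : mesh12 :=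
  shading [:: (0,0); (0,1); (1,0); (1,1); (1,2); (2,1); (2,2)].
Definition R5 : mesh12 :=
  shading [:: (0,0); (0,1); (1,0); (1,1); (1,2); (2,1)].
Definition R6 : mesh12 :=
  shading [:: (0,1); (0,2); (1,0); (1,1); (1,2); (2,1)].

(* Main.v *)
Require Import Defs.
From mathcomp Require Import zify.

Set Implicit Arguments.
Unset Strict Implicit.

Import GRing.Theory.

(** All six shadings contain the middle column and the middle row.  Shading
    both forces the two points of an occurrence to be adjacent in position and
    in value, which is exactly what a king permutation forbids; so no
    occurrence exists and every exponent of u vanishes. *)

Lemma occurrence_box_empty (R : mesh12) n (s : 'S_n) (i j m : 'I_n)
    (b : 'I_3 * 'I_3) :
  occurrence R s i j -> b \in R -> in_box s i j b m = false.
Proof.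
case/and3P=> _ _ /forall_inP oR bR; apply/negbTE.
by have := oR b bR; rewrite negb_exists => /forallP/(_ m).
Qed.

Section Cross.

Variables (R : mesh12) (n : nat) (s : 'S_n) (i j : 'I_n).
Hypothesis occR : occurrence R s i j.

Lemma occurrence_lt : (i < j) && (s i < s j).
Proof. by case/and3P: occR => -> ->. Qed.

(** If the positions were not adjacent, the entry at position [i.+1] would lie strictly inside the
    middle column. By injectivity its value is neither [s i] nor [s j], so it would fall in one of
    the three shaded boxes. *)
Lemma occurrence_adjacent_pos :
  (forall b : 'I_3 * 'I_3, b.1 = 1 :> nat -> b \in R) -> j = i.+1 :> nat.
Proof.
move=> colR; have /andP[ltij ltsij] := occurrence_lt.
apply/eqP; rewrite eqn_leq ltij andbT leqNgt; apply/negP => lti1j.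
have [m Em] : exists m : 'I_n, m = i.+1 :> nat.
  by exists (Ordinal (ltn_trans lti1j (ltn_ord j))).
have nsi : s m != s i :> nat.
  by rewrite (inj_eq val_inj) (inj_eq perm_inj) -(inj_eq val_inj) /=; lia.
have nsj : s m != s j :> nat.
  by rewrite (inj_eq val_inj) (inj_eq perm_inj) -(inj_eq val_inj) /=; lia.
have empty y (y3 : y < 3) :
    in_box s i j (Ordinal (isT : 1 < 3), Ordinal y3) m = false.
  by apply: (occurrence_box_empty m occR); apply: colR.
(* This is the upper bound [n.+1] of the top box; the three boxes then cover every value other than
   [s i] and [s j]. *)
have ltm := ltn_ord (s m).
have := empty 0 isT; have := empty 1 isT; have := empty 2 isT.
rewrite /in_box /pos_bound /val_bound /=; lia.
Qed.

(** The same argument transposed: the intruder is now the entry of value [(s i).+1], found through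
    the inverse permutation. *)
Lemma occurrence_adjacent_val :
  (forall b : 'I_3 * 'I_3, b.2 = 1 :> nat -> b \in R) -> s j = (s i).+1 :> nat.
Proof.
move=> rowR; have /andP[ltij ltsij] := occurrence_lt.
apply/eqP; rewrite eqn_leq ltsij andbT leqNgt; apply/negP => ltsi1.
have [m Em] : exists m : 'I_n, s m = (s i).+1 :> nat.
  by exists (s^-1 (Ordinal (ltn_trans ltsi1 (ltn_ord (s j)))))%g; rewrite permKV.
have nmi : m != i :> nat.
  by apply/eqP => /val_inj Emi; rewrite Emi in Em; lia.
have nmj : m != j :> nat.
  by apply/eqP => /val_inj Emj; rewrite Emj in Em; lia.
have empty x (x3 : x < 3) :
    in_box s i j (Ordinal x3, Ordinal (isT : 1 < 3)) m = false.
  by apply: (occurrence_box_empty m occR); apply: rowR.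
have ltm := ltn_ord m.
have := empty 0 isT; have := empty 1 isT; have := empty 2 isT.
rewrite /in_box /pos_bound /val_bound /=; lia.
Qed.

End Cross.

Lemma king_occ0 (R : mesh12) n (s : 'S_n) :
    (forall b : 'I_3 * 'I_3, b.1 = 1 :> nat \/ b.2 = 1 :> nat -> b \in R) ->
  king s -> occ R s = 0.
Proof.
move=> crossR kings; apply/eqP; rewrite cards_eq0; apply/eqP/setP => -[i j].
rewrite !inE /=; apply/negbTE/negP => occR.
have Ej : j = i.+1 :> nat.
  by apply: (occurrence_adjacent_pos occR) => b b1; apply: crossR; left.
have Es : s j = (s i).+1 :> nat.
  by apply: (occurrence_adjacent_val occR) => b b2; apply: crossR; right.
(* At adjacent positions the values differ by exactly 1, against the strict bound in [king]. *)
have /forallP/(_ i)/forallP/(_ j) := kings.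
rewrite Ej eqxx Es /=; lia.
Qed.

Lemma cross_shaded (R : mesh12) (b : 'I_3 * 'I_3) :
    R \in [:: R1; R2; R3; R4; R5; R6] ->
  b.1 = 1 :> nat \/ b.2 = 1 :> nat -> b \in R.
Proof.
(* Only the five boxes of the central cross survive, the middle one twice; each is looked up in all
   six shadings. *)
case: b => -[[|[|[|//]]] x3] -[[|[|[|//]]] y3] hR [] //= _; move: hR;
by rewrite !inE => /or3P[| |/or4P[]] /eqP->; rewrite inE.
Qed.

Theorem theorem3p1 (R : mesh12) (hR : R \in [:: R1; R2; R3; R4; R5; R6]) :
  king_gf R =1 A {poly int}.
Proof.
move=> n; rewrite /king_gf /A -sumr_const; apply: eq_bigr => s.
rewrite inE => kings; rewrite king_occ0 ?expr0 // => b.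
exact: cross_shaded.
Qed.
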